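(* Let $P(\lambda)=\lambda^\ell I_n+\lambda^{\ell-1}A_{\ell-1}+\cdots+\lambda A_1+A_0$ be an $n\times n$ complex matrix polynomial and consider its linearization $\lambda I-A$ with $$A=\begin{bmatrix} 0&I_n&0&\cdots&0 \\ 0&0&I_n&\cdots&0 \\ \vdots&\vdots&\vdots&\ddots&\vdots \\ 0&0&0&\cdots&I_n \\ -A_0&-A_1&-A_2&\cdots&-A_{\ell-1} \end{bmatrix}\in\mathbb{C}^{\ell n\times\ell n}.$$ Let $U\in\mathbb{C}^{n\times\ell n}$ have orthonormal rows and be such that $$M=\begin{bmatrix} U \\ U A \\ \vdots \\ U A^{\ell-1} \end{bmatrix}$$ is nonsingular and $MAM^{-1}$ is the block companion matrix $$\begin{bmatrix} 0&I_n&0&\cdots&0 \\ 0&0&I_n&\cdots&0 \\ \vdots&\vdots&\vdots&\ddots&\vdots \\ 0&0&0&\cdots&I_n \\ -T_0&-T_1&-T_2&\cdots&-T_{\ell-1} \end{bmatrix}$$ of a matrix polynomial $T(\lambda)=\lambda^\ell I_n+\lambda^{\ell-1}T_{\ell-1}+\cdots+\lambda T_1+T_0$ which is upper triangular and equivalent to $P(\lambda)$. Let $S_t\in\mathbb{C}^{n\times n}$ and let $Y_1$ be the first (top) $n\times n$ block of the $\ell n\times n$ matrix $$M^{-1}\begin{bmatrix} I_n \\ S_t \\ \vdots \\ S_t^{\ell-1} \end{bmatrix}.$$ If $Y_1$ is nonsingular and $S_t$ is a solvent for the triangularized problem, i.e. $T(S_t)=S_t^\ell+T_{\ell-1}S_t^{\ell-1}+\cdots+T_1S_t+T_0=0$,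 then $S=Y_1S_tY_1^{-1}$ is a solvent for $P$, i.e. $S^\ell+A_{\ell-1}S^{\ell-1}+\cdots+A_1S+A_0=0$.
   Context: Two $n\times n$ matrix polynomials $P(\lambda),T(\lambda)$ are equivalent if $T(\lambda)=E(\lambda)P(\lambda)F(\lambda)$ for matrix polynomials $E,F$ with constant nonzero determinants (unimodular). A linearization of a monic $n\times n$ matrix polynomial of degree $\ell$ is a pencil $\lambda I-A$ of size $\ell n\times\ell n$ that is equivalent to $\mathrm{diag}(P(\lambda),I_{(\ell-1)n})$. *)

(* Defs.v *)
From mathcomp Require Import all_boot all_order all_algebra.
From mathcomp Require Import reals complex.

Set Implicit Arguments.
Unset Strict Implicit.
Unset Printing Implicit Defensive.

Import GRing.Theory.
Local Open Scope ring_scope.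

(* A monic n x n matrix polynomial of degree l is given by its coefficients
   c 0, ..., c (l - 1).  Matrices of order l n made of n x n blocks have order
   \sum_(i < l) n, the type on which \mxblock and \mxcol are defined. *)

Definition monic_mxpoly (F : fieldType) (l n : nat) (c : 'I_l -> 'M[F]_n) :
    'M[{poly F}]_n :=
  'X^l *: 1%:M + \sum_(i < l) 'X^i *: map_mx polyC (c i).

Definition unimodular (F : fieldType) (n : nat) (E : 'M[{poly F}]_n) : Prop :=
  exists2 a : F, a != 0 & \det E = a%:P.

Definition mxpoly_equiv (F : fieldType) (n : nat) (P T : 'M[{poly F}]_n) : Prop :=
  exists E G : 'M[{poly F}]_n,
    [/\ unimodular E, unimodular G & T = E *m P *m G].

Definition upper_triangular (V : nmodType) (n : nat) (B : 'M[V]_n) : Prop :=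
  forall i j : 'I_n, (j < i)%N -> B i j = 0.

(* The last block row takes precedence, so that for l = 1 this is - c 0. *)
Definition block_companion (F : fieldType) (l n : nat) (c : 'I_l -> 'M[F]_n) :
    'M[F]_(\sum_(i < l) n) :=
  \mxblock_(i < l, j < l)
    (if i.+1 == l then - c j else if j == i.+1 :> nat then 1%:M else 0).

Definition krylov_mx (F : fieldType) (l n : nat)
    (U : 'M[F]_(n, \sum_(i < l) n)) (A : 'M[F]_(\sum_(i < l) n)) :
    'M[F]_(\sum_(i < l) n) :=
  \mxcol_(k < l) (U *m A ^+ k).

Definition power_col (F : fieldType) (l n : nat) (S : 'M[F]_n) :
    'M[F]_(\sum_(i < l) n, n) :=
  \mxcol_(k < l) (S ^+ k).

Definition solvent (F : fieldType) (l n : nat) (c : 'I_l -> 'M[F]_n)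
    (S : 'M[F]_n) : Prop :=
  S ^+ l + \sum_(i < l) c i *m S ^+ i = 0.

(* Main.v *)
Require Import Defs.
From mathcomp Require Import all_boot all_order all_algebra.
From mathcomp Require Import reals complex.

Set Implicit Arguments.
Unset Strict Implicit.
Unset Printing Implicit Defensive.

Import GRing.Theory.
Local Open Scope ring_scope.

(** For any monic matrix polynomial P with coefficients c, the relation
    C X = X S with its block companion matrix C is a recurrence on the blocks
    of X.  The first l - 1 block rows say that X k.+1 = X k * S, so X has the
    blocks Y * S ^ k with Y the top one, and the last block row then says
      Y S ^ l + c (l - 1) Y S ^ (l - 1) + ... + c 0 Y = 0.
    Hence [companion_invariantP]: such X correspond to the solutions Y of this
    equation, which for Y invertible means that Y S Y^-1 is a solvent of P
    ([solvent_conj]).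

    A solvent St of T thus gives C_T V = V St, where V is the column of powers
    of St (the case Y = 1).  As M A = C_T M, the column M^-1 V satisfies
    A (M^-1 V) = (M^-1 V) St.  Since A is itself the companion matrix of P,
    reading the same correspondence backwards shows that the top block Y1 of
    M^-1 V conjugates St to a solvent of P. *)

Lemma mul_block_companion (F : fieldType) (l n m : nat) (c : 'I_l -> 'M[F]_n)
    (X : 'I_l -> 'M[F]_(n, m)) :
  block_companion c *m \mxcol_k X k =
  \mxcol_i \sum_j
    (if i.+1 == l then - c j else if j == i.+1 :> nat then 1%:M else 0) *m X j.
Proof. by rewrite mul_mxblock_mxrow. Qed.

(** The identity blocks of the companion matrix shift the blocks of X, which
    makes them a geometric progression; the last block row closes the
    progression with the equation that the top block has to satisfy. *)
Lemma companion_invariantP (F : fieldType) (l n m : nat) (hl : (0 < l)%N)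
    (c : 'I_l -> 'M[F]_n) (X : 'M[F]_(\sum_(i < l) n, m)) (S : 'M[F]_m) :
  let Y := submxcol X (Ordinal hl) in
  block_companion c *m X = X *m S <->
  X = \mxcol_k (Y *m S ^+ k) /\
  Y *m S ^+ l + \sum_(i < l) c i *m (Y *m S ^+ i) = 0.
Proof.
move=> Y; split.
  rewrite -{1 2}[X]submxcolK mul_block_companion mxcol_mul => /eq_mxcolP eqX.
  have XE k (hk : (k < l)%N) : submxcol X (Ordinal hk) = Y *m S ^+ k.
    elim: k hk => [|k IHk] hk.
      by rewrite expr0 mulmx1; congr (submxcol X _); apply: val_inj.
    have := eqX (Ordinal (ltnW hk)); rewrite /= ltn_eqF // IHk.
    rewrite (bigD1 (Ordinal hk)) //= eqxx mul1mx big1 ?addr0 => [->|j].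
      by rewrite exprSr mulmxA.
    by rewrite -val_eqE /= => /negPf->; rewrite mul0mx.
  have XE' (k : 'I_l) : submxcol X k = Y *m S ^+ k by case: k => k hk; apply: XE.
  split; first by rewrite -[LHS]submxcolK; apply/eq_mxcolP.
  (* Row l - 1 of the relation, where X (l - 1) * S = Y * S ^ l. *)
  have hl1 : (l.-1 < l)%N by rewrite prednK.
  have := eqX (Ordinal hl1); rewrite /= prednK // eqxx XE.
  rewrite -mulmxA -[S ^+ l.-1 *m S]exprSr prednK // => <-.
  rewrite -big_split big1 //= => i _.
  by rewrite XE' mulNmx addNr.
case=> -> PY0; rewrite mul_block_companion mxcol_mul.
apply/eq_mxcolP => i; rewrite -mulmxA -[S ^+ i *m S]exprSr.
case: eqP => [->|/eqP li].
  apply/esym/eqP; rewrite -subr_eq0 -sumrN.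
  under eq_bigr do rewrite mulNmx opprK.
  exact/eqP.
have hi : (i.+1 < l)%N by rewrite ltn_neqAle li /=.
rewrite (bigD1 (Ordinal hi)) //= eqxx mul1mx big1 ?addr0 // => j.
by rewrite -val_eqE /= => /negPf->; rewrite mul0mx.
Qed.

Lemma solvent_conj (F : fieldType) (l n : nat) (c : 'I_l -> 'M[F]_n)
    (Y S : 'M[F]_n) :
  Y \in unitmx ->
  Y *m S ^+ l + \sum_(i < l) c i *m (Y *m S ^+ i) = 0 ->
  solvent c (Y *m S *m invmx Y).
Proof.
move=> uY PY0.
have powE k : (Y *m S *m invmx Y) ^+ k = Y *m S ^+ k *m invmx Y.
  elim: k => [|k IHk]; first by rewrite !expr0 mulmx1 mulmxV.
  by rewrite exprSr IHk -[_ * _]/(_ *m _) !mulmxA mulmxKV // exprSr !mulmxA.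
rewrite /solvent powE.
under eq_bigr do rewrite powE mulmxA.
by rewrite -mulmx_suml -mulmxDl PY0 mul0mx.
Qed.

Theorem theorem13 (R : realType) (l n : nat) (hl : (0 < l)%N)
    (Ac Tc : 'I_l -> 'M[R[i]]_n)
    (U : 'M[R[i]]_(n, \sum_(i < l) n)) (St : 'M[R[i]]_n) :
  let A := block_companion Ac in
  let M := krylov_mx U A in
  let Y1 := submxcol (invmx M *m power_col l St) (Ordinal hl) in
  U \is unitarymx ->
  M \in unitmx ->
  M *m A *m invmx M = block_companion Tc ->
  upper_triangular (monic_mxpoly Tc) ->
  mxpoly_equiv (monic_mxpoly Ac) (monic_mxpoly Tc) ->
  Y1 \in unitmx ->
  solvent Tc St ->
  solvent Ac (Y1 *m St *m invmx Y1).
Proof.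
move=> A M Y1 _ uM MAM _ _ uY1 TSt.
have CT : block_companion Tc *m power_col l St = power_col l St *m St.
  have topV : submxcol (power_col l St) (Ordinal hl) = 1%:M.
    by rewrite mxcolK expr0.
  apply/(companion_invariantP hl); rewrite topV mul1mx.
  split; first by apply/eq_mxcolP => k; rewrite mul1mx.
  by under eq_bigr do rewrite mul1mx.
have CA : A *m (invmx M *m power_col l St) = invmx M *m power_col l St *m St.
  by rewrite -[RHS]mulmxA -CT -MAM !mulmxA mulVmx // mul1mx.
by case/(companion_invariantP hl): CA => _; apply: solvent_conj.
Qed.
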